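(* Suppose the log-likelihood ratio $\ell$ is unbounded. Let $\epsilon>0$, $\delta\in(0,1)$, and let $\tilde T=\tilde T(b)$ be the $\delta$-DP-CUSUM stopping time (Laplace noise scale $2A_\delta/\epsilon$). Then for every $t\in\mathbb N$, every index $1\le k\le t$, and every pair of neighboring data streams $X_{(1:t)}$, $X'_{(1:t)}$ that differ only in their $k$-th entries $X_k$ and $X'_k$, $$\mathbf P_{\tilde T,X_k,X'_k}\big(\tilde T=t\mid X_{(1:t)\setminus k}\big)\le e^{\epsilon}\,\mathbf P_{\tilde T,X_k,X'_k}\big(\tilde T=t\mid X'_{(1:t)\setminus k}\big)+\delta .$$ Here the probability is over the internal randomness of $\tilde T$ (the Laplace noises) and over the differing entries $X_k,X'_k$, each of which is drawn from $f_0$ or $f_1$, independently of the noises, while the remaining entries (common to both streams) are fixed. On the left-hand side $\tilde T$ is run on the stream with $k$-th entry $X_k$; on the right-hand side it is run on the stream with $k$-th entry $X'_k$.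
   Context: Let $f_0\ne f_1$ be two known distinct probability density functions on $\mathbb R^d$ (pre- and post-change densities) and let $\ell(x)=\log(f_1(x)/f_0(x))$ be the log-likelihood ratio. For a data sequence $X_1,X_2,\ldots\in\mathbb R^d$, the CUSUM statistics are $S_0=0$ and, for $t\ge1$, $S_t=\max(0,S_{t-1})+\ell(X_t)$. For $\delta\in(0,1)$ define $$A_\delta=\inf\Big\{t:\max_{i=0,1}\mathbf P_{X\sim f_i}\big(2|\ell(X)|\ge t\big)\le\delta/2\Big\}.$$ $\mathrm{Lap}(\beta)$ denotes the Laplace distribution with density $\exp(-|x|/\beta)/(2\beta)$, $\beta>0$ (so it is understood that $A_\delta>0$). The $\delta$-DP-CUSUM procedure uses $\tilde S_t=S_t+Z_t$, where $Z_1,Z_2,\ldots$ are i.i.d. $\mathrm{Lap}(2A_\delta/\epsilon)$, and a single $W\sim\mathrm{Lap}(2A_\delta/\epsilon)$; $(Z_t)_{t\ge1}$, $W$ and the data are mutually independent. The stopping time with deterministic threshold $b$ is $\tilde T(b)=\inf\{t>0:\tilde S_t\ge b+W\}$. The notation $X_{(1:t)\setminus k}$ means the entries $X_1,\dots,X_t$ other than $X_k$; for the two neighboring streams these coincide. *)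

(* Defs.v *)
From HB Require Import structures.
From mathcomp Require Import all_boot all_order all_algebra.
From mathcomp Require Import finmap.
From mathcomp Require Import all_classical all_reals all_analysis.

Set Implicit Arguments.
Unset Strict Implicit.
Unset Printing Implicit Defensive.

Import Order.TTheory GRing.Theory Num.Theory.
Import numFieldNormedType.Exports.

Local Open Scope classical_set_scope.
Local Open Scope ring_scope.

(* R^d is d.-tuple R, whose sigma-algebra is generated by the coordinates. *)

Definition tcons (T : Type) (n : nat) (p : T * n.-tuple T) : n.+1.-tuple T :=
  [tuple of p.1 :: p.2].

Lemma measurable_tcons (R : realType) (n : nat) :
  measurable_fun [set: measurableTypeR R * n.-tuple R] (@tcons R n).
Proof. by apply: measurable_cons. Qed.

(* Image of Lebesgue(R) x mu under (a, v) |-> a :: v. *)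
Definition tcons_measure (R : realType) (n : nat)
    (mu : {measure set (n.-tuple R) -> \bar R}) :
    set (n.+1.-tuple R) -> \bar R :=
  pushforward (lebesgue_measure \x^ mu)%E (@tcons R n).

HB.instance Definition _ (R : realType) (n : nat)
    (mu : {measure set (n.-tuple R) -> \bar R}) :=
  Measure.copy (tcons_measure mu)
    (measure_function_pushforward__canonical__measure_function_Measure
      (lebesgue_measure \x^ mu)%E (@measurable_tcons R n)).

Fixpoint lebesgue_tuple (R : realType) (n : nat) :
    {measure set (n.-tuple R) -> \bar R} :=
  match n with
  | 0%N => dirac [tuple]
  | n'.+1 => tcons_measure (lebesgue_tuple R n')
  end.

Lemma lebesgue_tuple_box (R : realType) (n : nat) (B : 'I_n -> set R) :
  (forall i, measurable (B i)) ->
  lebesgue_tuple R n [set v | forall i, B i (tnth v i)] =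
  (\prod_(i < n) lebesgue_measure (B i))%E.
Proof.
elim: n B => [|n IH] B mB.
  by rewrite big_ord0 /= diracE mem_set//= => -[].
rewrite big_ord_recl -IH; last by move=> i; exact: mB.
rewrite /= /tcons_measure /pushforward /= -product_measure2E //; last first.
  rewrite (_ : [set v | _] = \bigcap_(i in [set: 'I_n])
    ((fun v : n.-tuple R => tnth v i) @^-1` B (lift ord0 i))); last first.
    by apply/seteqP; split=> v /= h i; [move=> _; exact: h|exact: h].
  apply: fin_bigcap_measurable => // i _; rewrite -[X in measurable X]setTI.
  exact: measurable_tnth.
  exact: mB.
congr (_ _); apply/seteqP; split=> -[a v]; rewrite /tcons /=.
  move=> h; split; first exact: (h ord0).
  by move=> i; have := h (lift ord0 i); rewrite tnthS.
move=> [h0 h] i; have [j|] := unliftP ord0 i => ->; last exact: h0.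
by rewrite tnthS; exact: h.
Qed.

Definition is_pdf (R : realType) (d : nat) (f : d.-tuple R -> R) : Prop :=
  [/\ measurable_fun [set: d.-tuple R] f,
      (forall x, 0 <= f x) &
      (\int[lebesgue_tuple R d]_x (f x)%:E = 1)%E].

Definition has_pdf (R : realType) (d : nat) (dO : measure_display)
    (Omega : measurableType dO) (P : probability Omega R)
    (X : {RV P >-> d.-tuple R}) (f : d.-tuple R -> R) : Prop :=
  forall A : set (d.-tuple R), measurable A ->
    distribution P X A = (\int[lebesgue_tuple R d]_(x in A) (f x)%:E)%E.

Definition laplace_pdf (R : realType) (beta x : R) : R :=
  expR (- `|x| / beta) / (2 * beta).

Definition has_laplace_law (R : realType) (dO : measure_display)
    (Omega : measurableType dO) (P : probability Omega R)
    (Z : {RV P >-> R}) (beta : R) : Prop :=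
  forall A : set R, measurable A ->
    distribution P Z A =
    (\int[lebesgue_measure]_(x in A) (laplace_pdf beta x)%:E)%E.

(* With the conventions of \bar R, the ratio is +oo and the logarithm is +oo
   where f0 = 0 < f1; the logarithm is -oo where f1 = 0.  In particular points
   with f0 = f1 = 0, where the ratio is undefined, get the value -oo. *)
Definition llr (R : realType) (d : nat) (f0 f1 : d.-tuple R -> R)
    (x : d.-tuple R) : \bar R :=
  lne ((f1 x)%:E / (f0 x)%:E)%E.

(* Points where f0 = f1 = 0 are outside the domain of the ratio. *)
Definition llr_unbounded (R : realType) (d : nat) (f0 f1 : d.-tuple R -> R) :
    Prop :=
  ~ exists M : R, forall x, ~ (f0 x = 0 /\ f1 x = 0) ->
      (`|llr f0 f1 x| <= M%:E)%E.

Definition llr_tail (R : realType) (d : nat) (f0 f1 f : d.-tuple R -> R)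
    (t : R) : \bar R :=
  (\int[lebesgue_tuple R d]_(x in [set x | t%:E <= 2%:E * `|llr f0 f1 x|])
    (f x)%:E)%E.

(* The infimum is taken in R, where inf set0 = 0: as every element of the set
   is positive, 0 < A_delta entails that the set is nonempty. *)
Definition A_delta (R : realType) (d : nat) (f0 f1 : d.-tuple R -> R)
    (delta : R) : R :=
  inf [set t : R | (maxe (llr_tail f0 f1 f0 t) (llr_tail f0 f1 f1 t)
                    <= (delta / 2)%:E)%E].

(* Data streams and noise sequences are indexed from 1; entry 0 is unused.
   Infinite values of llr are allowed; in \bar R, +oo + -oo = -oo. *)
Fixpoint cusum (R : realType) (d : nat) (f0 f1 : d.-tuple R -> R)
    (X : nat -> d.-tuple R) (t : nat) : \bar R :=
  match t with
  | 0%N => 0%E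
  | s.+1 => (maxe 0 (cusum f0 f1 X s) + llr f0 f1 (X s.+1))%E
  end.

Definition noisy_cusum (R : realType) (d : nat) (f0 f1 : d.-tuple R -> R)
    (z : nat -> R) (X : nat -> d.-tuple R) (t : nat) : \bar R :=
  (cusum f0 f1 X t + (z t)%:E)%E.

(* The value is +oo when the threshold is never crossed. *)
Definition stopping_time (R : realType) (d : nat) (f0 f1 : d.-tuple R -> R)
    (b : R) (z : nat -> R) (w : R) (X : nat -> d.-tuple R) : \bar R :=
  ereal_inf [set t%:R%:E | t in
    [set t : nat | (0 < t)%N /\
                   ((b + w)%:E <= noisy_cusum f0 f1 z X t)%E]].

Definition sigma_gen (R : realType) (dO dE : measure_display)
    (Omega : measurableType dO) (E : measurableType dE)
    (P : probability Omega R) (X : {RV P >-> E}) : set (set Omega) :=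
  preimage_set_system [set: Omega] X measurable.

Definition mutually_independent (R : realType) (dO : measure_display)
    (Omega : measurableType dO) (P : probability Omega R) (I : choiceType)
    (F : I -> set (set Omega)) : Prop :=
  forall (J : {fset I}) (A : I -> set Omega),
    (forall i, i \in J -> F i (A i)) ->
    (P (\bigcap_(i in [set` J]) A i) = \prod_(i <- J) P (A i))%E.

(* The sigma-algebras of X, of W and of Z_1, Z_2, ..., indexed respectively by
   None, Some None and Some (Some 0), Some (Some 1), ... *)
Definition sources (R : realType) (dO dE : measure_display)
    (Omega : measurableType dO) (E : measurableType dE)
    (P : probability Omega R) (X : {RV P >-> E}) (W : {RV P >-> R})
    (Z : nat -> {RV P >-> R}) (i : option (option nat)) : set (set Omega) :=
  match i with
  | None => sigma_gen X
  | Some None => sigma_gen W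
  | Some (Some s) => sigma_gen (Z s.+1)
  end.

(* Main.v *)
From HB Require Import structures.
Require Import Defs.
From mathcomp Require Import all_boot all_order all_algebra.
From mathcomp Require Import finmap.
From mathcomp Require Import all_classical all_reals all_analysis.
From mathcomp Require Import measurable_realfun lra ring.

Set Implicit Arguments.
Unset Strict Implicit.
Unset Printing Implicit Defensive.

Import Order.TTheory GRing.Theory Num.Theory.
Import numFieldNormedType.Exports.

Local Open Scope classical_set_scope.
Local Open Scope ring_scope.

(** Fix every entry of the stream except the [k]-th, and let [p u] be the
    probability, over the Laplace noises alone, that the procedure stops at
    time [t] when the [k]-th entry is [u].

    Call [u] typical when [2 * |llr u| <= A], with [A = A_delta]. If [u] and [v]
    are both typical, then [llr u] and [llr v] differ by at most [A], and so do
    the two trajectories of the CUSUM statistic; moreover one trajectory lies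
    above the other at all times ([le_cusum]). Condition on the noises
    [Z_1, ..., Z_(t-1)]. Stopping at [t] means that the maximum of the earlier
    noisy statistics is below [b + W] while [S_t + Z_t] is not. Because the
    trajectories are ordered, this maximum and [S_t] move in the same direction,
    so the event for [u] becomes the event for [v] after shifting [W] and [Z_t]
    by at most [A] each ([first_crossing_offset]). A shift of a Laplace variable
    of scale [2 * A / eps] by at most [A] changes probabilities by a factor at
    most [expR (eps / 2)] ([laplace_law_shift]); two shifts give
    [p u <= expR eps * p v] ([noise_law_stop_le]).

    By the definition of [A_delta] an entry drawn from either density is
    atypical with probability at most [delta / 2] ([A_delta_tail]). The two
    probabilities to be compared are the averages of [p] under the laws of the
    two entries, and comparing them on typical entries costs [delta / 2] for
    each of the two laws ([mixture_le]).

    That the stopping probability is such an average is Fubini's theorem for the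
    joint law of the entry and the noises. This law is a product measure because
    disjoint groups of mutually independent sources are independent
    ([indep_grouping], [law_sources]). *)

(** * Sensitivity of the stopping rule *)

Section deterministic.
Variable R : realType.
Implicit Types (a b : \bar R) (A c : R).

(** Infinite values cause no trouble: a finite gap [A] forces [a] and [b] to be
    infinite together, and then any offset will do. *)
Lemma offset_of_sandwich A a b : 0 <= A ->
  (a <= b <= a + A%:E)%E -> exists2 c, 0 <= c <= A & b = (a + c%:E)%E.
Proof.
case: a b => [a| |] [b| |] A0 /andP[] //=; last first.
- by move=> _ _; exists 0; rewrite ?lexx.
- by move=> _ _; exists 0; rewrite ?lexx.
- rewrite -EFinD !lee_fin => ab ba; exists (b - a); first by lra.
  by rewrite -EFinD; congr EFin; lra.
Qed.

(** The reflection at [0] and the addition of a common increment are monotone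
    and do not widen a gap, so replacing the [k]-th entry moves the whole
    trajectory by at most [A], and always in the same direction. *)
Lemma le_cusum d (f0 f1 : d.-tuple R -> R) (x : nat -> d.-tuple R) k u v A :
  0 <= A -> (llr f0 f1 u <= llr f0 f1 v <= llr f0 f1 u + A%:E)%E ->
  forall s, (cusum f0 f1 [eta x with k |-> u] s <=
             cusum f0 f1 [eta x with k |-> v] s <=
             cusum f0 f1 [eta x with k |-> u] s + A%:E)%E.
Proof.
move=> A0 /andP[uv vu].
set S := cusum f0 f1 [eta x with k |-> u]; set S' := cusum _ _ _.
have before s : (s < k)%N -> S s = S' s.
  elim: s => //= s ih sk; rewrite /S /S' /= -/S -/S' ih ?(ltnW sk)//.
  by rewrite (ltn_eqF sk).
elim => [|s /andP[ih1 ih2]].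
  by rewrite /S /S' /= lexx -EFinD lee_fin add0r.
rewrite /S /S' /= -/S -/S'; have [sk|sk] := eqVneq s.+1 k.
  rewrite (before s) ?sk ?leqnn//= ?eqxx.
  by rewrite leeD2l//= -addeA leeD2l.
rewrite leeD2r ?le_maxr//=; last first.
  by rewrite ge_max !le_max lexx/= ih1 orbT.
rewrite addeAC leeD2r// ge_max; apply/andP; split.
  by rewrite -[leLHS]adde0 leeD ?le_max ?lexx// lee_fin.
by rewrite (le_trans ih2)// leeD2r// le_max lexx orbT.
Qed.

(** The noise [zt] at time [t] is kept apart from the earlier noises [z],
    because only [zt] and the threshold noise [w] get shifted. *)
Definition first_crossing (b : R) (S : nat -> \bar R) (t : nat)
    (z : nat -> R) (w zt : R) : Prop :=
  (forall s, (0 < s < t)%N -> (S s + (z s)%:E < (b + w)%:E)%E) /\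
  ((b + w)%:E <= S t + zt%:E)%E.

Lemma stopping_time_eq d (f0 f1 : d.-tuple R -> R) (b : R) z w X t :
  (0 < t)%N ->
  stopping_time f0 f1 b z w X = t%:R%:E <->
  first_crossing b (cusum f0 f1 X) t z w (z t).
Proof.
move=> t0; rewrite /stopping_time; set D := [set n : nat | _ /\ _].
have lb n : D n -> (ereal_inf [set s%:R%:E | s in D] <= (n%:R : R)%:E)%E.
  by move=> Dn; apply: ereal_inf_lbound; exists n.
split=> [Et|[nc ct]].
- split=> [s /andP[s0 st]|].
    rewrite ltNge; apply/negP => cs; have := lb s.
    by rewrite Et lee_fin ler_nat leqNgt st => /(_ (conj s0 cs)).
  have [[n Dn]|D0] := pselect (exists n, D n); last first.
    move: Et; rewrite (_ : [set _ | _ in D] = set0) ?ereal_inf0//.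
    by rewrite -subset0 => _ [n Dn <-]; apply: D0; exists n.
  have exD : exists n, `[< D n >] by exists n; exact/asboolP.
  have [m /asboolP Dm minm] := ex_minnP exD.
  have Em : ereal_inf [set s%:R%:E | s in D] = (m%:R : R)%:E.
    apply/eqP; rewrite eq_le lb//=; apply/ereal_infP => _ [s Ds <-].
    by rewrite lee_fin ler_nat minm//; exact/asboolP.
  move: Et; rewrite Em => -[/eqP]; rewrite eqr_nat => /eqP Emt.
  by move: Dm; rewrite Emt => -[_].
- apply/eqP; rewrite eq_le lb//=; apply/ereal_infP => _ [s [s0 cs] <-].
  rewrite lee_fin ler_nat leqNgt; apply/negP => st.
  by have := nc s; rewrite s0 st ltNge => /(_ isT)/negP; apply.
Qed.

(** Only the maximum [g] of the earlier noisy statistics matters for not having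
    crossed before [t]. The maximum and the statistic at [t] move up by some
    [c] and [c'] in [[0, A]], so moving [w] by [c] and [zt] by [c - c'] restores
    the event. Both moves stay within [A] because [c] and [c'] have the same
    sign; in general [c - c'] would only be bounded by [2 * A]. *)
Lemma first_crossing_offset (b A : R) (S S' : nat -> \bar R) t z :
  0 <= A -> (forall s, S s <= S' s <= S s + A%:E)%E ->
  exists c1 c2, [/\ `|c1| <= A, `|c2| <= A & forall w zt,
    first_crossing b S t z w zt <-> first_crossing b S' t z (w + c1) (zt + c2)].
Proof.
move=> A0 SS'.
pose g (V : nat -> \bar R) :=
  \big[maxe/-oo%E]_(s < t | (0 < s)%N) (V s + (z s)%:E)%E.
have gP V w : (forall s, (0 < s < t)%N -> (V s + (z s)%:E < (b + w)%:E)%E) <->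
    (g V < (b + w)%:E)%E.
  split=> [h|/bigmax_ltP[_ h] s /andP[s0 st]]; last exact: (h (Ordinal st)).
  apply/bigmax_ltP; split; first by rewrite ltNyr.
  by move=> i i0; apply: h; rewrite i0/=.
have /offset_of_sandwich[//|c c0 Ec] : (g S <= g S' <= g S + A%:E)%E.
  apply/andP; split.
    by apply: le_bigmax2 => i _; rewrite leeD2r//; case/andP: (SS' i).
  apply/bigmax_leP; split; first exact: leNye.
  move=> i i0; have /andP[_ h] := SS' i.
  rewrite (le_trans (leeD2r _ h))// addeAC leeD2r//.
  exact: (le_bigmax_cond _ (fun j : 'I_t => (S j + (z j)%:E)%E)).
have [c' c'0 Ec'] := offset_of_sandwich A0 (SS' t).
exists c, (c - c'); split; [rewrite ler_norml; lra|rewrite ler_norml; lra|].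
move=> w zt; rewrite /first_crossing !gP Ec Ec'.
have -> : (b + (w + c) = b + w + c)%R by lra.
rewrite -addeA -EFinD (_ : c' + _ = zt + c); last by lra.
by rewrite !EFinD lteD2rE// addeA leeD2rE.
Qed.

End deterministic.

(** * Shifts of the Laplace law *)

Section laplace.
Variable R : realType.
Local Notation mu := (@lebesgue_measure R).

Lemma lebesgue_measure_shift (c : R) (A : set R) : measurable A ->
  pushforward mu (fun x : measurableTypeR R => x + c : measurableTypeR R) A =
  mu A.
Proof.
have mc : measurable_fun setT
    (fun x : measurableTypeR R => x + c : measurableTypeR R).
  exact: measurable_funD.
move=> mA; apply/esym/lebesgue_measure_unique => //= _ [[a b]] _ <-.
rewrite /pushforward.
have -> : (fun x => x + c) @^-1` `]a, b] = `]a - c, b - c]%classic.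
  by apply/seteqP; split=> x /=; rewrite !in_itv/= ltrBlDr lerBrDr.
by rewrite !lebesgue_measure_itv/= !lte_fin ltrD2r -!EFinB opprB addrA subrK.
Qed.

Lemma ge0_integral_shift (c : R) (B : set R) (f : R -> \bar R) :
  measurable B -> measurable_fun setT f -> (forall x, 0 <= f x)%E ->
  (\int[mu]_(x in (fun x => x + c)%R @^-1` B) f (x + c)%R =
   \int[mu]_(x in B) f x)%E.
Proof.
move=> mB mf f0.
have mc : measurable_fun setT
    (fun x : measurableTypeR R => x + c : measurableTypeR R).
  exact: measurable_funD.
have mfB : measurable_fun B f by exact: measurable_funS mf.
rewrite -(ge0_integral_pushforward mc mu mB mfB)//.
apply: eq_measure_integral => A mA _.
by rewrite -[RHS](lebesgue_measure_shift c).
Qed.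

Lemma measurable_laplace_pdf (beta : R) :
  measurable_fun setT (laplace_pdf beta).
Proof.
apply: measurable_funM => //; apply: measurableT_comp => //.
apply: measurable_funM => //; apply: measurableT_comp => //.
Qed.

Lemma laplace_pdf_shift (beta c x : R) : 0 < beta ->
  laplace_pdf beta x <= expR (`|c| / beta) * laplace_pdf beta (x + c).
Proof.
move=> b0; rewrite /laplace_pdf mulrA -expRD ler_wpM2r//.
  by rewrite invr_ge0 mulr_ge0// ltW.
rewrite ler_expR -mulrDl ler_wpM2r ?invr_ge0 ?(ltW b0)//.
by have := ler_normD x c; lra.
Qed.

(** A shift by [c] changes the Laplace density by a factor at most
    [expR (`|c| / beta)], and the Lebesgue measure does not see the shift. *)
Lemma laplace_law_shift d (Omega : measurableType d) (P : probability Omega R)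
    (Z : {RV P >-> R}) (beta c : R) (B : set R) :
  0 < beta -> has_laplace_law Z beta -> measurable B ->
  (distribution P Z ((fun x => x + c)%R @^-1` B) <=
   (expR (`|c| / beta))%:E * distribution P Z B)%E.
Proof.
move=> b0 hZ mB.
have p0 x : 0 <= laplace_pdf beta x.
  by rewrite mulr_ge0 ?invr_ge0 ?mulr_ge0 ?expR_ge0// ltW.
have mp := measurable_laplace_pdf beta.
have mc : measurable_fun setT
    (fun x : measurableTypeR R => x + c : measurableTypeR R).
  exact: measurable_funD.
have mcB : measurable ((fun x => x + c)%R @^-1` B : set R).
  by rewrite -[X in measurable X]setTI; exact: mc.
have mep : measurable_fun setT (fun x => (laplace_pdf beta x)%:E).
  exact/measurable_EFinP.
have mep' : measurable_fun setT
    (fun x => (expR (`|c| / beta))%:E * (laplace_pdf beta x)%:E)%E.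
  exact: measurable_funeM.
have e0 := expR_ge0 (`|c| / beta).
rewrite !hZ// -(ge0_integralZl mu mB (measurable_funTS mep))//; last first.
  by move=> x _; rewrite lee_fin.
rewrite -(ge0_integral_shift c mB mep'); last first.
  by move=> x; rewrite -EFinM lee_fin mulr_ge0.
apply: ge0_le_integral => //=.
- by move=> x _; rewrite lee_fin.
- exact: measurable_funTS mep.
- apply: measurable_funTS.
  by have := measurableT_comp mep' mc.
- by move=> x _; rewrite -EFinM lee_fin laplace_pdf_shift.
Qed.

End laplace.

(** * Independence of groups of sources *)

Section grouping.
Context (R : realType) (dO : measure_display) (Omega : measurableType dO).
Variables (P : probability Omega R) (I : choiceType).
Implicit Types (F : I -> set (set Omega)) (K : set I).

(** A pi-system that generates the sigma-algebra of the sources in [K]. *)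
Definition cylinders F K : set (set Omega) :=
  [set B | exists (J : {fset I}) (A : I -> set Omega),
    [/\ [set` J] `<=` K, forall i, i \in J -> F i (A i) &
        B = \bigcap_(i in [set` J]) A i]].

Lemma cylinders_setI F K : (forall i, setI_closed (F i)) ->
  setI_closed (cylinders F K).
Proof.
move=> FI _ _ [J1 [A1 [J1K F1 ->]]] [J2 [A2 [J2K F2 ->]]].
pose A i := (if i \in J1 then A1 i else setT) `&`
            (if i \in J2 then A2 i else setT).
exists (J1 `|` J2)%fset, A; split.
- by move=> i /=; rewrite in_fsetU => /orP[|]; [exact: J1K|exact: J2K].
- move=> i; rewrite in_fsetU /A.
  by case: ifPn => i1; case: ifPn => i2 // _;
    rewrite ?setIT ?setTI; [apply: FI|..]; auto.
- apply/seteqP; split=> w.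
  + move=> [h1 h2] i /=; rewrite in_fsetU /A => _.
    by split; case: ifPn => // ?; [exact: h1|exact: h2].
  + move=> h; split=> i /= iJ; have := h i;
      rewrite /= in_fsetU /A iJ ?orbT => /(_ isT)[];
      by case: ifPn.
Qed.

Lemma cylinders_setT F K : cylinders F K setT.
Proof.
exists fset0, (fun=> setT); split=> //.
by apply/seteqP; split.
Qed.

Lemma sub_cylinders F K i : K i -> F i `<=` cylinders F K.
Proof.
move=> Ki A FA; exists [fset i]%fset, (fun=> A); split.
- by move=> j /=; rewrite in_fset1 => /eqP ->.
- by move=> j; rewrite in_fset1 => /eqP ->.
- by rewrite set_fset1 bigcap_set1.
Qed.

Lemma measurable_cylinders F K : (forall i, F i `<=` measurable) ->
  cylinders F K `<=` measurable.
Proof.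
move=> Fm _ [J [A [_ FA ->]]]; apply: fin_bigcap_measurable => //.
by move=> i iJ; apply/Fm/FA.
Qed.

(** The product rule for the union of the two finite index sets factors into
    the product rules for each of them. *)
Lemma indep_cylinders F K1 K2 B1 B2 : mutually_independent P F ->
  [disjoint K1 & K2] -> cylinders F K1 B1 -> cylinders F K2 B2 ->
  (P (B1 `&` B2) = P B1 * P B2)%E.
Proof.
move=> indF /disj_set2P K12 [J1 [A1 [J1K F1 ->]]] [J2 [A2 [J2K F2 ->]]].
have J12 i : i \in J2 -> (i \in J1) = false.
  move=> i2; apply/negP => i1; suff : (K1 `&` K2) i by rewrite K12.
  by split; [exact: J1K|exact: J2K].
pose A i := if i \in J1 then A1 i else A2 i.
have E1 : \bigcap_(i in [set` J1]) A1 i = \bigcap_(i in [set` J1]) A i.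
  by apply: eq_bigcapr => i /= i1; rewrite /A i1.
have E2 : \bigcap_(i in [set` J2]) A2 i = \bigcap_(i in [set` J2]) A i.
  by apply: eq_bigcapr => i /= i2; rewrite /A J12.
have FA1 i : i \in J1 -> F i (A i) by move=> i1; rewrite /A i1; exact: F1.
have FA2 i : i \in J2 -> F i (A i) by move=> i2; rewrite /A J12//; exact: F2.
rewrite E1 E2 -bigcap_setU -set_fsetU !indF//; last first.
  by move=> i; rewrite in_fsetU => /orP[|]; auto.
rewrite (big_fsetID _ (mem J1)); congr (_ * _)%E.
  apply: eq_fbigl => i; rewrite !inE/=.
  by case: (i \in J1); rewrite ?andbF.
apply: eq_fbigl => i; rewrite !inE/=.
by have := J12 i; case: (i \in J2); case: (i \in J1) => //= /(_ isT).
Qed.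

(** Both sides are finite measures in [A] that agree on a pi-system. *)
Lemma indep_g_sigma_algebra (G : set (set Omega)) B :
  setI_closed G -> G setT -> G `<=` measurable -> measurable B ->
  (forall A, G A -> P (A `&` B) = P A * P B)%E ->
  forall A, <<s G >> A -> (P (A `&` B) = P A * P B)%E.
Proof.
move=> GI GT Gm mB indG A sA.
have PB0 : 0 <= fine (P B) by rewrite fine_ge0.
pose m1 : {measure set Omega -> \bar R} := mrestr P mB.
pose m2 : {measure set Omega -> \bar R} := mscale (NngNum PB0) P.
have m2E C : m2 C = (P C * P B)%E.
  by rewrite /m2 /= /mscale/= fineK ?fin_num_measure// muleC.
rewrite -m2E -[LHS]/(m1 A).
apply: (@g_sigma_algebra_measure_unique _ _ _ G Gm (fun=> setT)) => //.
- by rewrite bigcup_const.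
- by move=> C GC; rewrite m2E; exact: indG.
- by move=> _; rewrite /m1 /= /mrestr setTI ltey_eq fin_num_measure.
Qed.

(** The product rule is extended from cylinders to sigma-algebras in one
    argument at a time. *)
Lemma indep_grouping F K1 K2 B1 B2 : mutually_independent P F ->
  (forall i, setI_closed (F i)) -> (forall i, F i `<=` measurable) ->
  [disjoint K1 & K2] -> <<s cylinders F K1 >> B1 -> <<s cylinders F K2 >> B2 ->
  (P (B1 `&` B2) = P B1 * P B2)%E.
Proof.
move=> indF FI Fm K12 sB1 sB2.
have cI K := @cylinders_setI F K FI.
have cT K := cylinders_setT F K.
have cm K := @measurable_cylinders F K Fm.
have sm K : <<s cylinders F K >> `<=` measurable.
  exact: smallest_sub (@sigma_algebra_measurable _ Omega) (cm K).
apply: indep_g_sigma_algebra sB1 => //; first exact: sm sB2.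
move=> A1 cA1; rewrite setIC muleC.
apply: indep_g_sigma_algebra sB2 => //; first exact: cm cA1.
by move=> A2 cA2; rewrite setIC muleC; exact: (indep_cylinders indF K12).
Qed.

End grouping.

Section joint_law.
Context (R : realType) (dO d1 d2 : measure_display) (Omega : measurableType dO).
Context (E1 : measurableType d1) (E2 : measurableType d2).
Variable (P : probability Omega R).

Lemma joint_law (X : Omega -> E1) (Y : Omega -> E2)
    (mu : {sigma_finite_measure set E1 -> \bar R})
    (nu : {sigma_finite_measure set E2 -> \bar R}) :
  measurable_fun setT X -> measurable_fun setT Y ->
  (forall A, measurable A -> P (X @^-1` A) = mu A) ->
  (forall B, measurable B -> P (Y @^-1` B) = nu B) ->
  (forall A B, measurable A -> measurable B ->
    P (X @^-1` A `&` Y @^-1` B) = P (X @^-1` A) * P (Y @^-1` B))%E ->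
  forall D, measurable D -> (P [set w | D (X w, Y w)] = (mu \x nu) D)%E.
Proof.
move=> mX mY PX PY indXY D mD.
have mXY : measurable_fun setT (fun w => (X w, Y w)).
  exact: measurable_fun_pair.
rewrite -[LHS]/(pushforward P (fun w => (X w, Y w)) D).
apply/esym/product_measure_unique => //= A B mA mB.
by rewrite -PX// -PY// -indXY.
Qed.

End joint_law.

(** * Measurability of the stopping event *)

Section event.
Variable R : realType.

(** Both densities are nonnegative, so away from their zeros the log-likelihood
    ratio is a difference of logarithms; the conventions for infinite values
    give the constants on the other pieces. *)
Lemma measurable_llr d (f0 f1 : d.-tuple R -> R) :
  is_pdf f0 -> is_pdf f1 -> measurable_fun setT (llr f0 f1).
Proof.
move=> [mf0 p0 _] [mf1 p1 _].
rewrite [X in measurable_fun _ X](_ : _ = fun x =>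
    if 0 < f1 x then if 0 < f0 x then (ln (f1 x) - ln (f0 x))%:E else +oo%E
    else -oo%E); last first.
  apply/funext => x; rewrite /llr inver.
  have := p1 x; rewrite le_eqVlt => /predU1P[<-|f1x].
    by rewrite mul0e ltxx le0_lneNy.
  rewrite f1x; have := p0 x; rewrite le_eqVlt => /predU1P[<-|f0x].
    by rewrite eqxx ltxx gt0_muley.
  by rewrite gt_eqF// f0x -EFinM lne_EFin ?divr_gt0// ln_div.
apply: measurable_fun_ifT => //.
  exact: measurable_fun_ltr.
apply: measurable_fun_ifT => //.
  exact: measurable_fun_ltr.
apply/measurable_EFinP/measurable_funB;
  by apply: measurableT_comp => //; exact: measurable_ln.
Qed.

Lemma measurable_cusum d (f0 f1 : d.-tuple R -> R) x k s :
  is_pdf f0 -> is_pdf f1 ->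
  measurable_fun setT (fun u => cusum f0 f1 [eta x with k |-> u] s).
Proof.
move=> pf0 pf1; elim: s => [|s ih] /=; first exact: measurable_cst.
apply: emeasurable_funD.
  by apply: measurable_maxe => //; exact: measurable_cst.
by rewrite /=; case: (s.+1 == k); [exact: measurable_llr|exact: measurable_cst].
Qed.

(** The nesting of the product type follows the order of integration: the
    random entry, the noises [Z_1, ..., Z_n], and last the two noises that get
    shifted, namely the threshold noise and [Z_(n+1)]. Coordinate [s.-1] of the
    tuple holds [Z_s]. *)
Definition stop_event d (f0 f1 : d.-tuple R -> R) (b : R)
    (x : nat -> d.-tuple R) (k n : nat) :
    set (d.-tuple R * (n.-tuple R * (R * R))) :=
  [set y : _ * (n.-tuple R * _) |
    first_crossing b (cusum f0 f1 [eta x with k |-> y.1]) n.+1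
      (fun s => nth 0 y.2.1 s.-1) y.2.2.1 y.2.2.2].

#[local] Arguments stop_event {d} f0 f1 b x k n _.

Lemma measurable_stop_event d (f0 f1 : d.-tuple R -> R) b x k n :
  is_pdf f0 -> is_pdf f1 -> measurable (stop_event f0 f1 b x k n).
Proof.
move=> pf0 pf1.
set T := (d.-tuple R * (n.-tuple R * (R * R)))%type.
have mw : measurable_fun setT (fun y : T => y.2.2.1).
  exact: measurableT_comp (measurableT_comp measurable_fst measurable_snd)
    measurable_snd.
have mz : measurable_fun setT (fun y : T => y.2.2.2).
  exact: measurableT_comp (measurableT_comp measurable_snd measurable_snd)
    measurable_snd.
have mv i : measurable_fun setT (fun y : T => nth 0 y.2.1 i).
  have [ni|ni] := leqP n i.
    under eq_fun do rewrite nth_default ?size_tuple//.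
    exact: measurable_cst.
  have E y : nth 0 (y : T).2.1 i = tnth y.2.1 (Ordinal ni).
    by rewrite (tnth_nth 0).
  under eq_fun do rewrite E.
  exact: measurableT_comp (measurable_tnth (Ordinal ni))
    (measurableT_comp measurable_fst measurable_snd).
have mb : measurable_fun setT (fun y : T => (b + y.2.2.1)%:E).
  by apply/measurable_EFinP; exact: measurable_funD.
have mS s : measurable_fun setT
    (fun y : T => cusum f0 f1 [eta x with k |-> y.1] s).
  exact: measurableT_comp (measurable_cusum _ _ _ pf0 pf1) measurable_fst.
have -> : stop_event f0 f1 b x k n =
    (\bigcap_(s in [set s | (0 < s < n.+1)%N])
      [set y : T | (cusum f0 f1 [eta x with k |-> y.1] s + (nth 0 y.2.1 s.-1)%:E
                    < (b + y.2.2.1)%:E)%E]) `&`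
    [set y : T | ((b + y.2.2.1)%:E <=
        cusum f0 f1 [eta x with k |-> y.1] n.+1 + (y.2.2.2)%:E)%E].
  by apply/seteqP; split.
apply: measurableI.
  apply: bigcap_measurableType => s _; rewrite -[X in measurable X]setTI.
  apply: measurable_lte => //; apply: emeasurable_funD => //.
  exact/measurable_EFinP.
rewrite -[X in measurable X]setTI; apply: measurable_lee => //.
by apply: emeasurable_funD => //; exact/measurable_EFinP.
Qed.

End event.
Arguments stop_event {R d} f0 f1 b x k n _.

(** * The joint law of the entry and the noises *)

(** The currying only serves to let the structure of each factor be inferred. *)
Definition prod_law (R : realType) d1 d2 (T1 : measurableType d1)
    (T2 : measurableType d2) (mu : subprobability T1 R)
    (nu : subprobability T2 R) : subprobability (T1 * T2)%type R :=
  product_subprobability (mu, nu).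

Section noise.
Context (R : realType) (dO dE : measure_display).
Context (Omega : measurableType dO) (E : measurableType dE).
Variables (P : probability Omega R).

Lemma sigma_gen_measurable d' (T : measurableType d') (X : {RV P >-> T}) :
  sigma_gen X `<=` measurable.
Proof. by move=> _ [A mA <-]; exact: measurable_funPT. Qed.

Lemma sigma_gen_setI d' (T : measurableType d') (X : {RV P >-> T}) :
  setI_closed (sigma_gen X).
Proof.
move=> _ _ [A mA <-] [B mB <-]; exists (A `&` B); first exact: measurableI.
by rewrite preimage_setI !setTI.
Qed.

Lemma measurable_cylinders_source (I : choiceType) (F : I -> set (set Omega))
    (K : set I) i d' (T : measurableType d') (X : {RV P >-> T}) :
  K i -> F i = sigma_gen X ->
  measurable_fun [set: g_sigma_algebraType (cylinders F K)] X.
Proof.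
move=> Ki Fi _ A mA; apply: sub_sigma_algebra; apply: (sub_cylinders Ki).
by rewrite Fi; exists A.
Qed.

Variables (X : {RV P >-> E}) (W : {RV P >-> R}) (Z : nat -> {RV P >-> R}).

Definition past_noise n (w : Omega) : n.-tuple R := [tuple Z i.+1 w | i < n].

Lemma measurable_past_noise n : measurable_fun setT (past_noise n).
Proof.
apply/measurable_fun_tnthP => i.
rewrite (_ : _ \o _ = Z i.+1); first exact: measurable_funPT.
by apply/funext => w; rewrite /= tnth_mktuple.
Qed.

HB.instance Definition _ n :=
  isMeasurableFun.Build _ _ _ _ (past_noise n) (@measurable_past_noise n).

Lemma indep_source_groups (K1 K2 : set (option (option nat)))
    d1 d2 (E1 : measurableType d1) (E2 : measurableType d2)
    (Y1 : Omega -> E1) (Y2 : Omega -> E2) A1 A2 :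
  mutually_independent P (sources X W Z) -> [disjoint K1 & K2] ->
  measurable_fun [set: g_sigma_algebraType (cylinders (sources X W Z) K1)] Y1 ->
  measurable_fun [set: g_sigma_algebraType (cylinders (sources X W Z) K2)] Y2 ->
  measurable A1 -> measurable A2 ->
  (P (Y1 @^-1` A1 `&` Y2 @^-1` A2) = P (Y1 @^-1` A1) * P (Y2 @^-1` A2))%E.
Proof.
move=> indep K12 mY1 mY2 mA1 mA2; apply: (indep_grouping indep _ _ K12).
- by case=> [[s|]|]; exact: sigma_gen_setI.
- by case=> [[s|]|]; exact: sigma_gen_measurable.
- by rewrite -[X in _ X]setTI; exact: mY1.
- by rewrite -[X in _ X]setTI; exact: mY2.
Qed.

(** This is the joint law of the noises only when they are independent, which
    [law_sources] assumes. *)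
Definition noise_law n : subprobability (n.-tuple R * (R * R))%type R :=
  prod_law (distribution P (past_noise n))
    (prod_law (distribution P W) (distribution P (Z n.+1))).

(** Independence of groups of sources peels off one factor of the product law
    at a time: the data entry from all the noises, the earlier noises from the
    two that get shifted, and finally these two from each other. *)
Lemma law_sources n : mutually_independent P (sources X W Z) ->
  forall D, measurable D ->
  (P [set w | D (X w, (past_noise n w, (W w, Z n.+1 w)))] =
   (distribution P X \x noise_law n) D)%E.
Proof.
move=> indep.
set F := sources X W Z in indep *.
(* the index [Some (Some s)] stands for [Z s.+1] *)
pose past := [set i : option (option nat) |
  if i is Some (Some s) then (s < n)%N else False].
have mX K : K None ->
    measurable_fun [set: g_sigma_algebraType (cylinders F K)] X.
  by move=> KX; exact: (measurable_cylinders_source (X := X) KX).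
have mW K : K (Some None) ->
    measurable_fun [set: g_sigma_algebraType (cylinders F K)] W.
  by move=> KW; exact: (measurable_cylinders_source (X := W) KW).
have mZ K s : K (Some (Some s)) ->
    measurable_fun [set: g_sigma_algebraType (cylinders F K)] (Z s.+1).
  by move=> KZ; exact: (measurable_cylinders_source (X := Z s.+1) KZ).
have mV K : past `<=` K ->
    measurable_fun [set: g_sigma_algebraType (cylinders F K)] (past_noise n).
  move=> pK; apply/measurable_fun_tnthP => i.
  rewrite (_ : _ \o _ = Z i.+1); first by apply: mZ; apply: pK; exact: ltn_ord.
  by apply/funext => w; rewrite /= tnth_mktuple.
have mWZ K : K (Some None) -> K (Some (Some n)) ->
    measurable_fun [set: g_sigma_algebraType (cylinders F K)]
      (fun w => (W w, Z n.+1 w)).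
  by move=> KW KZ; apply: measurable_fun_pair; [exact: mW|exact: mZ].
have mWZT : measurable_fun setT (fun w => (W w, Z n.+1 w)).
  by apply: measurable_fun_pair; exact: measurable_funPT.
apply: joint_law => //.
- apply: measurable_fun_pair => //; exact: measurable_past_noise.
- apply: (joint_law (mu := distribution P (past_noise n))
    (nu := prod_law (distribution P W) (distribution P (Z n.+1)))) => //.
  + apply: (joint_law (mu := distribution P W)
      (nu := distribution P (Z n.+1))) => //.
    move=> A B mA mB.
    apply: (@indep_source_groups [set Some None] [set Some (Some n)]) => //.
    * by apply/disj_set2P/seteqP; split=> // i [/= -> //].
    * exact: mW.
    * exact: mZ.
  + move=> A B mA mB.
    apply: (@indep_source_groups past [set Some None; Some (Some n)]) => //.
    * apply/disj_set2P/seteqP; split=> // i [] /[swap] -[-> //|->] /=.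
      by rewrite ltnn.
    * exact: mV.
    * by apply: mWZ; [left|right].
- move=> A B mA mB.
  apply: (@indep_source_groups [set None] [set~ None]) => //.
  + by apply/disj_set2P; rewrite setICr.
  + exact: mX.
  + apply: measurable_fun_pair; last by apply: mWZ.
    by apply: mV => -[].
Qed.

End noise.

(** * Inequalities for product measures and mixtures *)

Section mixture.
Local Open Scope ereal_scope.

Lemma product_measureC (R : realType) d1 d2 (T1 : measurableType d1)
    (T2 : measurableType d2) (mu : probability T1 R) (nu : probability T2 R) D :
  measurable D -> (mu \x nu) D = (mu \x^ nu) D.
Proof.
move=> mD; apply: product_measure_unique => // A B mA mB.
exact: product_measure2E.
Qed.

(** One coordinate is shifted at a time, integrating over the other one; the
    two orders of integration are exchanged in between. *)
Lemma product_measure_shift (R : realType) (mu nu : probability R R)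
    (c1 c2 k : R) (D : set (R * R)) : (0 <= k)%R ->
  (forall B, measurable B -> mu ((fun x => x + c1)%R @^-1` B) <= k%:E * mu B) ->
  (forall B, measurable B -> nu ((fun x => x + c2)%R @^-1` B) <= k%:E * nu B) ->
  measurable D ->
  (mu \x nu) [set y | D (y.1 + c1, y.2 + c2)%R] <= (k * k)%:E * (mu \x nu) D.
Proof.
move=> k0 hmu hnu mD.
pose D1 := [set y : R * R | D (y.1 + c1, y.2)%R].
pose D2 := [set y : R * R | D (y.1 + c1, y.2 + c2)%R].
have mD1 : measurable D1.
  rewrite -[X in measurable X]setTI.
  apply: (measurable_fun_pair (f := fun y : R * R => (y.1 + c1)%R)
    (g := snd)) => //.
  exact: measurable_funD.
have mD2 : measurable D2.
  rewrite -[X in measurable X]setTI.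
  apply: (measurable_fun_pair (f := fun y : R * R => (y.1 + c1)%R)
    (g := fun y : R * R => (y.2 + c2)%R)) => //; exact: measurable_funD.
rewrite -/D2 EFinM -muleA; apply: (@le_trans _ _ (k%:E * (mu \x nu) D1)).
  rewrite /product_measure1 -ge0_integralZl//; last first.
    exact: measurable_fun_xsection.
  apply: ge0_le_integral => //.
  - exact: measurable_fun_xsection.
  - by apply: measurable_funeM; exact: measurable_fun_xsection.
  - move=> w _ /=; rewrite
      (_ : xsection D2 w = (fun z => z + c2)%R @^-1` xsection D1 w).
      by apply: hnu; exact: measurable_xsection.
    by apply/seteqP; split=> z; rewrite /xsection/= !inE.
rewrite lee_wpmul2l ?lee_fin//.
rewrite !product_measureC// /product_measure2 -ge0_integralZl//; last first.
  exact: measurable_fun_ysection.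
apply: ge0_le_integral => //.
- exact: measurable_fun_ysection.
- by apply: measurable_funeM; exact: measurable_fun_ysection.
- move=> z _ /=; rewrite
    (_ : ysection D1 z = (fun w => w + c1)%R @^-1` ysection D z).
    by apply: hmu; exact: measurable_ysection.
  by apply/seteqP; split=> w; rewrite /ysection/= !inE.
Qed.

(** Integrating [p u <= k * p v] in [u] over [G] gives
    [L - delta / 2 <= k * p v] for the left-hand side [L], since [p <= 1] bounds
    the part outside [G]. Integrating this in [v] over [G], whose mass is at
    least [1 - delta / 2], loses at most another [delta / 2] because
    [L <= 1]. *)
Lemma mixture_le (R : realType) dE (E : measurableType dE)
    (mu nu : probability E R) (p : E -> \bar R) (G : set E) (k delta : R) :
  (0 <= k)%R -> (0 < delta < 1)%R -> measurable G ->
  mu (~` G) <= (delta / 2)%:E -> nu (~` G) <= (delta / 2)%:E ->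
  measurable_fun setT p -> (forall u, 0 <= p u <= 1) ->
  (forall u v, G u -> G v -> p u <= k%:E * p v) ->
  \int[mu]_u p u <= k%:E * (\int[nu]_u p u) + delta%:E.
Proof.
move=> k0 /andP[d0 d1] mG muG nuG mp p01 hp.
have p0 u : 0 <= p u by case/andP: (p01 u).
have p1 u : p u <= 1 by case/andP: (p01 u).
have mGC : measurable (~` G) by exact: measurableC.
have intG (la : probability E R) : \int[la]_u p u =
    \int[la]_(u in G) p u + \int[la]_(u in ~` G) p u.
  rewrite -ge0_integral_setU ?setUv//; exact/disj_setPCl.
have cstG (la : probability E R) (F : set E) c : measurable F -> 0 <= c ->
    (forall u, F u -> p u <= c) -> \int[la]_(u in F) p u <= c * la F.
  move=> mF c0 hc; rewrite -integral_cst//; apply: ge0_le_integral => //.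
  exact: measurable_funTS.
have step v : G v -> \int[mu]_u p u <= k%:E * p v + (delta / 2)%:E.
  move=> Gv; rewrite intG; apply: leeD.
    have c0 : 0 <= k%:E * p v by rewrite mule_ge0 ?lee_fin.
    apply: (le_trans (cstG mu G _ mG c0 (fun u Gu => hp u v Gu Gv))).
    by rewrite -[leRHS]mule1 lee_wpmul2l// probability_le1.
  apply: le_trans muG; rewrite -[leRHS]mul1e.
  by apply: cstG => //.
have L1 : \int[mu]_u p u <= 1.
  apply: le_trans (cstG mu setT 1 measurableT _ _) _ => //.
  by rewrite probability_setT mule1.
have L0 : 0 <= \int[mu]_u p u by exact: integral_ge0.
have [l El] : exists l, \int[mu]_u p u = l%:E.
  exists (fine (\int[mu]_u p u)); rewrite fineK// ge0_fin_numE//.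
  by rewrite (le_lt_trans L1)// ltry.
rewrite El in L0 L1 step *; rewrite !lee_fin in L0 L1.
have [g Eg] : exists g, nu G = g%:E.
  by exists (fine (nu G)); rewrite fineK// fin_num_measure.
have g1 : (1 - delta / 2 <= g)%R.
  by move: nuG; rewrite probability_setC// Eg -EFinB lee_fin; lra.
have N0 : 0 <= k%:E * \int[nu]_u p u.
  by rewrite mule_ge0 ?lee_fin// integral_ge0.
have [ld|ld] := leP l (delta / 2)%R.
  by rewrite -[leLHS]add0e leeD// lee_fin; lra.
have lower : ((l - delta / 2) * g)%:E <= k%:E * \int[nu]_u p u.
  rewrite EFinM -Eg -integral_cst//.
  apply: (@le_trans _ _ (\int[nu]_(u in G) (k%:E * p u))).
    apply: ge0_le_integral => //.
    - by move=> u _; rewrite lee_fin; lra.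
    - by apply: measurable_funTS; exact: measurable_funeM.
    - by move=> u Gu; rewrite /cst EFinB leeBlDr// step.
  rewrite ge0_integralZl//; last exact: measurable_funTS.
  rewrite lee_wpmul2l ?lee_fin// intG leeDl//.
  by apply: integral_ge0.
apply: (le_trans _ (leeD2r _ lower)); rewrite -EFinD lee_fin.
by nra.
Qed.

End mixture.

(** * Typical entries *)

Section typical.
Context (R : realType) (d : nat) (f0 f1 : d.-tuple R -> R).
Hypotheses (pf0 : is_pdf f0) (pf1 : is_pdf f1).

Definition typical (A : R) : set (d.-tuple R) :=
  [set u | (2%:E * `|llr f0 f1 u| <= A%:E)%E].

Lemma measurable_typical A : measurable (typical A).
Proof.
rewrite /typical -[X in measurable X]setTI; apply: measurable_lee => //.
apply: measurable_funeM; apply: measurableT_comp => //.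
exact: measurable_llr.
Qed.

Lemma llr_close A u v : typical A u -> typical A v ->
  (llr f0 f1 u <= llr f0 f1 v <= llr f0 f1 u + A%:E)%E \/
  (llr f0 f1 v <= llr f0 f1 u <= llr f0 f1 v + A%:E)%E.
Proof.
rewrite /typical /=.
case: (llr f0 f1 u) => [l| |] //=; last 2 first.
- by rewrite gt0_muley ?lte_fin// leNgt ltry.
- by rewrite gt0_muley ?lte_fin// leNgt ltry.
case: (llr f0 f1 v) => [m| |] //=; last 2 first.
- by rewrite gt0_muley ?lte_fin// leNgt ltry.
- by rewrite gt0_muley ?lte_fin// leNgt ltry.
rewrite -!EFinM -!EFinD !lee_fin => hl hm.
have := ler_norm l; have := ler_norm m.
have := ler_norm (- l); have := ler_norm (- m); rewrite !normrN.
by have [lm|ml] := leP l m; [left|right]; lra.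
Qed.

(** The infimum defining [A_delta] need not be attained, so the tail bound is
    known only above [A_delta]; the event that [2 |l|] exceeds [A_delta] is the
    increasing union of these tails. Positivity of [A_delta] rules out that the
    infimum is taken over the empty set. *)
Lemma A_delta_tail (delta : R) dO (Omega : measurableType dO)
    (P : probability Omega R) (X : {RV P >-> d.-tuple R}) :
  0 < A_delta f0 f1 delta -> has_pdf X f0 \/ has_pdf X f1 ->
  (distribution P X (~` typical (A_delta f0 f1 delta)) <= (delta / 2)%:E)%E.
Proof.
set A := A_delta f0 f1 delta => A0 hX.
pose tail t := [set u | (t%:E <= 2%:E * `|llr f0 f1 u|)%E].
have mtail t : measurable (tail t).
  rewrite /tail -[X in measurable X]setTI; apply: measurable_lee => //.
  apply: measurable_funeM; apply: measurableT_comp => //.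
  exact: measurable_llr.
set T := [set t : R | (maxe (llr_tail f0 f1 f0 t) (llr_tail f0 f1 f1 t)
                    <= (delta / 2)%:E)%E].
have T0 : T !=set0.
  apply/set0P/negP => /eqP T0; move: A0.
  by rewrite /A /A_delta -/T T0 inf0 ltxx.
have small t : A < t -> (distribution P X (tail t) <= (delta / 2)%:E)%E.
  move=> /(inf_lt T0)[s Ts st].
  apply: (@le_trans _ _ (distribution P X (tail s))).
    apply: le_measure; rewrite ?inE// => u; rewrite /tail/=.
    by apply: le_trans; rewrite lee_fin ltW.
  move: Ts; rewrite /T/= ge_max => /andP[T0s T1s].
  by case: hX => ->.
pose F n := tail (A + n.+1%:R^-1).
have approx (e : \bar R) : (A%:E < e)%E ->
    exists n, ((A + n.+1%:R^-1)%:E <= e)%E.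
  case: e => [r| |]; last by rewrite ltNge leNye.
    rewrite lte_fin => /ltr_add_invr[n nr].
    by exists n; rewrite lee_fin ltW.
  by move=> _; exists 0%N; rewrite leey.
have -> : ~` typical A = \bigcup_n F n.
  apply/seteqP; split=> u /=.
    by move/negP; rewrite -ltNge => /approx[n An]; exists n.
  case=> n _ h; apply/negP; rewrite -ltNge.
  by apply: lt_le_trans h; rewrite lte_fin ltrDl invr_gt0.
have cF : distribution P X (F n) @[n --> \oo] -->
    distribution P X (\bigcup_n F n).
  apply: nondecreasing_cvg_mu => //.
  - by move=> n; exact: mtail.
  - by apply: bigcup_measurable => n _; exact: mtail.
  - move=> m n mn; apply/subsetPset => u; rewrite /F /tail /=.
    by apply: le_trans; rewrite lee_fin lerD2l lef_pV2 ?posrE// ler_nat ltnS.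
rewrite -(cvg_lim _ cF)//; apply: lime_le; first exact: cvgP cF.
by apply: nearW => n; apply: small; rewrite ltrDl invr_gt0.
Qed.

(** Which of the two trajectories is the upper one depends on the entries; in
    one case the offsets change sign. *)
Lemma first_crossing_typical (A b : R) (x : nat -> d.-tuple R) k t z u v :
  0 <= A -> typical A u -> typical A v ->
  exists c1 c2, [/\ `|c1| <= A, `|c2| <= A & forall w zt,
    first_crossing b (cusum f0 f1 [eta x with k |-> u]) t z w zt <->
    first_crossing b (cusum f0 f1 [eta x with k |-> v]) t z (w + c1) (zt + c2)].
Proof.
move=> A0 Gu Gv; have [uv|vu] := llr_close Gu Gv.
  exact/first_crossing_offset/le_cusum.
have [c1 [c2 [c1A c2A E]]] :=
  first_crossing_offset b t z A0 (le_cusum x k A0 vu).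
by exists (- c1), (- c2); split; rewrite ?normrN// => w zt; rewrite E !subrK.
Qed.

(** With scale [2 * A / eps] each of the two shifts by at most [A] costs a
    factor [expR (eps / 2)]; this is done for each value of the earlier noises
    separately. *)
Lemma noise_law_stop_le (A eps b : R) dO (Omega : measurableType dO)
    (P : probability Omega R) (Z : nat -> {RV P >-> R}) (W : {RV P >-> R})
    (x : nat -> d.-tuple R) k n u v :
  0 < A -> 0 < eps ->
  has_laplace_law (Z n.+1) (2 * A / eps) -> has_laplace_law W (2 * A / eps) ->
  typical A u -> typical A v ->
  (noise_law W Z n (xsection (stop_event f0 f1 b x k n) u) <=
   (expR eps)%:E * noise_law W Z n (xsection (stop_event f0 f1 b x k n) v))%E.
Proof.
move=> A0 eps0 lZ lW Gu Gv.
set S := stop_event f0 f1 b x k n.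
have mS : measurable S by exact: measurable_stop_event.
have e0 : 0 <= expR (eps / 2) by exact: expR_ge0.
have shift (Y : {RV P >-> R}) (c : R) (B : set R) :
    has_laplace_law Y (2 * A / eps) -> `|c| <= A -> measurable B ->
    (distribution P Y ((fun y => y + c)%R @^-1` B) <=
     (expR (eps / 2))%:E * distribution P Y B)%E.
  move=> lY cA mB; have beta0 : 0 < 2 * A / eps by rewrite divr_gt0// mulr_gt0.
  apply: (le_trans (laplace_law_shift c beta0 lY mB)).
  rewrite lee_wpmul2r// lee_fin ler_expR ler_pdivrMr//.
  by rewrite (_ : eps / 2 * (2 * A / eps) = A)//; field; rewrite gt_eqF.
have mSu u' : measurable (xsection S u') by exact: measurable_xsection.
pose nu := prod_law (distribution P W) (distribution P (Z n.+1)).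
have noiseE T : noise_law W Z n T =
    (\int[distribution P (past_noise Z n)]_y nu (xsection T y))%E by [].
have mnu u' : measurable_fun setT (fun y => nu (xsection (xsection S u') y)).
  exact: measurable_fun_xsection.
rewrite !noiseE -ge0_integralZl//.
apply: ge0_le_integral => //; first exact: measurable_funeM.
move=> y _.
have [c1 [c2 [c1A c2A E]]] := first_crossing_typical b x k n.+1
  (fun s => nth 0 y s.-1) (ltW A0) Gu Gv.
have -> : xsection (xsection S u) y =
    [set q | xsection (xsection S v) y (q.1 + c1, q.2 + c2)].
  by apply/seteqP; split=> -[w zt];
    rewrite /xsection /= !inE /= !inE /S /stop_event /= => /E.
rewrite [in leRHS](_ : eps = eps / 2 + eps / 2) ?expRD; last by lra.
apply: (product_measure_shift (mu := distribution P W)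
  (nu := distribution P (Z n.+1))) => //.
- by move=> B mB; exact: shift.
- by move=> B mB; exact: shift.
- exact: measurable_xsection.
Qed.

End typical.

(** * The privacy guarantee *)

Section assembly.
Context (R : realType) (d : nat) (f0 f1 : d.-tuple R -> R).
Hypotheses (pf0 : is_pdf f0) (pf1 : is_pdf f1).

Lemma nth_past_noise dO (Omega : measurableType dO)
    (P : probability Omega R) (Z : nat -> {RV P >-> R}) n w s :
  (0 < s < n.+1)%N -> nth 0 (past_noise Z n w) s.-1 = Z s w.
Proof.
case: s => // s /andP[_]; rewrite ltnS => sn /=.
have := tnth_nth 0 (past_noise Z n w) (Ordinal sn).
by rewrite tnth_mktuple => <-.
Qed.

Lemma stopping_time_law (b : R) dO (Omega : measurableType dO)
    (P : probability Omega R) (Z : nat -> {RV P >-> R}) (W : {RV P >-> R})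
    (X : {RV P >-> d.-tuple R}) (x : nat -> d.-tuple R) k n :
  mutually_independent P (sources X W Z) ->
  (P [set w | stopping_time f0 f1 b (fun s => Z s w) (W w)
                [eta x with k |-> X w] = n.+1%:R%:E] =
   \int[distribution P X]_u
     noise_law W Z n (xsection (stop_event f0 f1 b x k n) u))%E.
Proof.
move=> indep.
transitivity ((distribution P X \x noise_law W Z n)
    (stop_event f0 f1 b x k n))%E; last by [].
rewrite -law_sources//; last exact: measurable_stop_event.
congr (P _); apply/seteqP; split=> w /=;
  rewrite stopping_time_eq// /stop_event /first_crossing /= => -[before now];
  split=> // s sn; have := before s sn; by rewrite nth_past_noise.
Qed.

End assembly.

Theorem theorem4 (R : realType) (d : nat) (f0 f1 : d.-tuple R -> R)
    (f0_pdf : is_pdf f0) (f1_pdf : is_pdf f1) (f0_neq_f1 : f0 <> f1)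
    (llr_unbdd : llr_unbounded f0 f1)
    (eps delta b : R) (eps_gt0 : 0 < eps)
    (delta_gt0 : 0 < delta) (delta_lt1 : delta < 1)
    (A_gt0 : 0 < A_delta f0 f1 delta)
    (dO : measure_display) (Omega : measurableType dO)
    (P : probability Omega R)
    (Z : nat -> {RV P >-> R}) (W : {RV P >-> R})
    (Xk Xk' : {RV P >-> d.-tuple R})
    (Z_law : forall s : nat, (0 < s)%N ->
       has_laplace_law (Z s) (2 * A_delta f0 f1 delta / eps))
    (W_law : has_laplace_law W (2 * A_delta f0 f1 delta / eps))
    (Xk_law : has_pdf Xk f0 \/ has_pdf Xk f1)
    (Xk'_law : has_pdf Xk' f0 \/ has_pdf Xk' f1)
    (Xk_indep : mutually_independent P (sources Xk W Z))
    (Xk'_indep : mutually_independent P (sources Xk' W Z))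
    (t k : nat) (k_ge1 : (1 <= k)%N) (k_le_t : (k <= t)%N)
    (x : nat -> d.-tuple R) :
  (P [set w | stopping_time f0 f1 b (fun s => Z s w) (W w)
                [eta x with k |-> Xk w] = t%:R%:E]
   <= (expR eps)%:E *
      P [set w | stopping_time f0 f1 b (fun s => Z s w) (W w)
                   [eta x with k |-> Xk' w] = t%:R%:E]
      + delta%:E)%E.
Proof.
case: t k_le_t => [|n _]; first by rewrite leqNgt k_ge1.
rewrite (stopping_time_law f0_pdf f1_pdf b x k n Xk_indep).
rewrite (stopping_time_law f0_pdf f1_pdf b x k n Xk'_indep).
have mS := measurable_stop_event b x k f0_pdf f1_pdf (n := n).
apply: (@mixture_le _ _ _ _ _ _ (typical f0 f1 (A_delta f0 f1 delta))).
- exact: expR_ge0.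
- by rewrite delta_gt0.
- exact: measurable_typical.
- exact: A_delta_tail.
- exact: A_delta_tail.
- exact: (measurable_fun_xsection (noise_law W Z n)).
- move=> u; apply/andP; split; first exact: measure_ge0.
  apply: (@le_trans _ _ (noise_law W Z n setT)); last exact: sprobability_setT.
  by apply: le_measure; rewrite ?inE//; exact: measurable_xsection.
- move=> u v Gu Gv.
  by apply: (noise_law_stop_le _ _ _ _ _ A_gt0) => //; exact: Z_law.
Qed.
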